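(* Let $k\ge 2$ and $s\ge 0$ be integers and let $\vec b=(b_0,b_1,b_2,\dots)$ be a sequence of integers. Then for every positive integer $m$, the sequence $(C^{\vec b}_{k,s,n})_{n\ge 1}$ of $k$-dimensional $s$-bounded weighted Catalan numbers is eventually periodic modulo $m$; that is, there exist positive integers $N$ and $t$ such that $C^{\vec b}_{k,s,n+t}\equiv C^{\vec b}_{k,s,n}\pmod m$ for all $n\ge N$.
   Context: A $k$-dimensional Balanced ballot path of $kn$ steps is a lattice path in $\mathbb{Z}^k$ from $(0,\dots,0)$ to $(n,\dots,n)$ with $kn$ steps, each step being one of the standard unit vectors $\vec e_1,\dots,\vec e_k$, such that every point $x=(x_1,\dots,x_k)$ on the path satisfies $x_1\ge x_2\ge\cdots\ge x_k$. An up-step is a step $\vec e_1$. The height of a point $x\in\mathbb{Z}^k$ is $h_k(x)=(k-1)x_1-\sum_{i=2}^k x_i$. The weight of such a path $P$ with respect to $\vec b$ is $wt_{\vec b}(P)=b_{h_1}b_{h_2}\cdots b_{h_n}$, where $h_i$ is the height of the starting point of the $i$-th up-step of $P$. The $k$-dimensional $s$-bounded weighted Catalan number is $C^{\vec b}_{k,s,n}=\sum_P wt_{\vec b}(P)$, the sum over all $k$-dimensional Balanced ballot paths $P$ of $kn$ steps all of whose points $x$ satisfy $h_k(x)\le s$. *)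

(* Defs.v *)
From mathcomp Require Import all_boot all_order all_algebra.

Set Implicit Arguments.
Unset Strict Implicit.
Unset Printing Implicit Defensive.

Import Order.TTheory GRing.Theory Num.Theory.
Local Open Scope ring_scope.

(* Coordinates are indexed from 0: the point (x_1, ..., x_k) has
   x_(i + 1) = x 0 i for i : 'I_k, and the up-step is
   unitv (ord_first k_gt1). *)
Definition unitv (k : nat) (i : 'I_k) : 'rV[int]_k := delta_mx 0 i.

Definition ord_first (k : nat) (k_gt1 : (1 < k)%N) : 'I_k :=
  Ordinal (ltnW k_gt1).

(* A path is encoded by the sequence of the directions of its steps;
   path_point p j is the point reached from the origin after j steps. *)
Definition path_point (k : nat) (p : seq 'I_k) (j : nat) : 'rV[int]_k :=
  \sum_(i <- take j p) unitv i.

Definition weakly_decreasing (k : nat) (x : 'rV[int]_k) : bool :=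
  [forall i : 'I_k, forall j : 'I_k, (i <= j)%N ==> (x 0 j <= x 0 i)].

Definition balanced_ballot_path (k n : nat) (p : (k * n).-tuple 'I_k) : bool :=
  (path_point p (k * n) == const_mx n%:Z) &&
  [forall j : 'I_(k * n).+1, weakly_decreasing (path_point p j)].

Definition height (k : nat) (k_gt1 : (1 < k)%N) (x : 'rV[int]_k) : int :=
  (k%:Z - 1) * x 0 (ord_first k_gt1) - \sum_(i < k | (0 < i)%N) x 0 i.

(* Weakly decreasing points have nonnegative height, so the absolute value
   below only serves to read the height as an index of b. *)
Definition path_weight (k : nat) (k_gt1 : (1 < k)%N) (b : nat -> int)
    (n : nat) (p : (k * n).-tuple 'I_k) : int :=
  \prod_(j < k * n | tnth p j == ord_first k_gt1)
    b `|height k_gt1 (path_point p j)|%N.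

Definition height_bounded (k : nat) (k_gt1 : (1 < k)%N) (s n : nat)
    (p : (k * n).-tuple 'I_k) : bool :=
  [forall j : 'I_(k * n).+1, height k_gt1 (path_point p j) <= s%:Z].

Definition bounded_weighted_catalan (k : nat) (k_gt1 : (1 < k)%N)
    (b : nat -> int) (s n : nat) : int :=
  \sum_(p : (k * n).-tuple 'I_k |
        balanced_ballot_path p && height_bounded k_gt1 s p)
    path_weight k_gt1 b p.

(* Main.v *)
Require Import Defs.
From mathcomp Require Import all_boot all_order all_algebra.

(** The set of points that a bounded path may visit is finite up to
    translation along the diagonal.  Indeed [height x] is the sum of the
    deficits [x_1 - x_i], so at a weakly decreasing point of height at most
    [s] each deficit lies between [0] and [s], and the deficits determine the
    point up to a multiple of [(1, ..., 1)].  Weights, the ballot condition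
    and the height bound are all unchanged by such a translation.

    Let [walk_sum L x] be the weighted sum over the bounded ballot paths of
    [L] steps that start at [x] and end anywhere on the diagonal.  Splitting
    off the first step expresses [walk_sum L.+1] linearly in [walk_sum L],
    with coefficients that do not depend on [L].  By translation invariance
    ([walk_sum_shift]) the function [walk_sum L] modulo [m] amounts to a map
    from the finite set of deficit vectors to the residues modulo [m]
    ([residues]); there are finitely many such maps and each one determines
    the next ([residues_step]), so by the pigeonhole principle
    ([eventually_periodic_iter]) they are eventually periodic in [L].
    Finally a path of [k * n] steps from the origin that ends on the diagonal
    ends at [(n, ..., n)], because each step adds [1] to the sum of the
    coordinates; hence the Catalan number is [walk_sum (k * n) 0]
    ([bounded_weighted_catalan_walk_sum]), and a period of [walk_sum] in [L] is
    also a period in [n]. *)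

Set Implicit Arguments.
Unset Strict Implicit.
Unset Printing Implicit Defensive.

Import Order.TTheory GRing.Theory Num.Theory.
Local Open Scope ring_scope.

(** * Eventual periodicity of finite-state recurrences *)

(** Two indices carry the same state by the pigeonhole principle.  The
    hypothesis says that each state determines its successor, so the two
    sequences that start at these indices agree for ever. *)
Lemma eventually_periodic_iter (S : finType) (u : nat -> S) :
    (forall i j, u i = u j -> u i.+1 = u j.+1) ->
  exists N t, (0 < t)%N /\ forall n, (N <= n)%N -> u (n + t)%N = u n.
Proof.
move=> ustep.
have /injectivePn[i [j neq_ij eq_uij]] :
    ~~ injectiveb (fun i : 'I_#|S|.+1 => u i).
  by apply/injectiveP=> /leq_card; rewrite card_ord ltnn.
wlog lt_ij : i j neq_ij eq_uij / (i < j)%N.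
  move=> IH; case: (ltngtP i j) => [||eq_ij]; first exact: IH.
    by apply: IH; rewrite // eq_sym.
  by rewrite (val_inj eq_ij) eqxx in neq_ij.
exists i, (j - i)%N; split=> [|n]; first by rewrite subn_gt0.
elim: n => [|n IHn].
  by rewrite leqn0 => /eqP i0; move: eq_uij; rewrite i0 subn0.
rewrite leq_eqVlt => /predU1P[<-|]; first by rewrite subnKC // ltnW.
by rewrite ltnS addSn => /IHn; apply: ustep.
Qed.

(** * Sums over tuples and steps of a path *)

Lemma big_tuple_cons (R : nmodType) (I : finType) (L : nat)
    (F : L.+1.-tuple I -> R) :
  \sum_p F p = \sum_i \sum_(p : L.-tuple I) F [tuple of i :: p].
Proof.
rewrite pair_big /=.
rewrite (reindex (fun ip : I * L.-tuple I => [tuple of ip.1 :: ip.2])) //=.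
exists (fun p : L.+1.-tuple I => (thead p, [tuple of behead p])).
  by move=> [i p] _; congr (_, _); apply: val_inj.
by move=> p _; rewrite [RHS]tuple_eta.
Qed.

Lemma forall_ordS (L : nat) (P : nat -> bool) :
  [forall j : 'I_L.+1, P j] = P 0%N && [forall j : 'I_L, P j.+1].
Proof.
apply/forallP/andP=> [PP | [P0 /forallP PS] [[|j] lt_j]] //=.
  by split; [exact: (PP ord0) | apply/forallP=> j; exact: (PP (lift ord0 j))].
exact: (PS (Ordinal (lt_j : (j < L)%N))).
Qed.

Lemma path_point0 (k : nat) (p : seq 'I_k) : path_point p 0 = 0.
Proof. by rewrite /path_point take0 big_nil. Qed.

Lemma path_point_cons (k : nat) (i : 'I_k) (p : seq 'I_k) (j : nat) :
  path_point (i :: p) j.+1 = unitv i + path_point p j.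
Proof. by rewrite /path_point /= big_cons. Qed.

Lemma sum_unitv (k : nat) (i : 'I_k) : \sum_j unitv i 0 j = 1.
Proof.
rewrite (bigD1 i) //= big1 ?mxE ?eqxx ?addr0 // => j /negPf ne_ji.
by rewrite mxE ne_ji andbF.
Qed.

Lemma sum_path_point (k : nat) (p : seq 'I_k) (j : nat) :
  (j <= size p)%N -> \sum_i path_point p j 0 i = j%:Z.
Proof.
elim: j p => [|j IHj] [|i p] //=.
- by rewrite path_point0 big1 // => i _; rewrite mxE.
- by rewrite path_point0 big1 // => i' _; rewrite mxE.
rewrite ltnS => /IHj IH; rewrite path_point_cons.
under eq_bigr do rewrite mxE.
by rewrite big_split /= IH sum_unitv.
Qed.

(** * Weighted sums over walks *)

Section Walks.

Variables (k : nat) (k_gt1 : (1 < k)%N) (s : nat) (b : nat -> int).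

Local Notation up := (ord_first k_gt1).

Definition admissible (x : 'rV[int]_k) : bool :=
  weakly_decreasing x && (height k_gt1 x <= s%:Z).

Definition on_diagonal (x : 'rV[int]_k) : bool := x == const_mx (x 0 up).

Definition step_weight (x : 'rV[int]_k) (i : 'I_k) : int :=
  if i == up then b `|height k_gt1 x|%N else 1.

(** Defined by splitting off the first step: this is the transfer recurrence
    that drives the proof, and [walk_sum_tuples] identifies its solution with
    the sum over paths.  The target is the whole diagonal rather than a fixed
    point, which is what makes the sum invariant under translation. *)
Fixpoint walk_sum (L : nat) (x : 'rV[int]_k) : int :=
  if admissible x then
    if L is L'.+1 then \sum_i step_weight x i * walk_sum L' (x + unitv i)
    else (on_diagonal x)%:R
  else 0.

Lemma walk_sum_tuples (L : nat) (x : 'rV[int]_k) :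
  walk_sum L x =
  \sum_(p : L.-tuple 'I_k |
        [forall j : 'I_L.+1, admissible (x + path_point p j)]
          && on_diagonal (x + path_point p L))
    \prod_(j < L) step_weight (x + path_point p j) (tnth p j).
Proof.
elim: L x => [|L IHL] x /=.
  rewrite big_mkcond (big_pred1 [tuple]) => [|p]; last by apply/esym/eqP; apply: tuple0.
  rewrite path_point0 addr0 big_ord0.
  rewrite (forall_ordS 0 (fun j => admissible (x + path_point [::] j))).
  rewrite path_point0 addr0 (_ : [forall j : 'I_0, _]) ?andbT; last first.
    by apply/forallP=> [] [].
  by case: admissible; case: on_diagonal.
rewrite [RHS]big_mkcond big_tuple_cons.
case: (boolP (admissible x)) => [adm_x | nadm_x]; last first.
  rewrite big1 // => i _; rewrite big1 // => p _.
  rewrite (forall_ordS L.+1 (fun j => admissible (x + path_point (i :: p) j))).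
  by rewrite path_point0 addr0 (negPf nadm_x).
apply: eq_bigr => i _; rewrite IHL big_distrr [LHS]big_mkcond /=.
apply: eq_bigr => p _.
rewrite (forall_ordS L.+1 (fun j => admissible (x + path_point (i :: p) j))).
rewrite path_point0 addr0 adm_x path_point_cons addrA /=.
under [in RHS]eq_forallb do rewrite path_point_cons addrA.
case: ifP => // _; rewrite big_ord_recl path_point0 addr0; congr (_ * _).
by apply: eq_bigr => j _; rewrite path_point_cons addrA tnthS.
Qed.

(** Each step adds [1] to the sum of the coordinates, so a diagonal point
    reached in [k * n] steps can only be [(n, ..., n)]. *)
Lemma path_point_diagonal (n : nat) (p : (k * n).-tuple 'I_k) :
  (path_point p (k * n) == const_mx n%:Z)
    = on_diagonal (path_point p (k * n)).
Proof.
rewrite /on_diagonal; set y := path_point _ _.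
have sum_y : \sum_i y 0 i = (k * n)%:Z by rewrite sum_path_point ?size_tuple.
apply/eqP/eqP=> [-> | diag_y]; first by rewrite mxE.
rewrite diag_y; congr const_mx; move: sum_y; rewrite diag_y.
under eq_bigr do rewrite mxE.
rewrite sumr_const card_ord -mulr_natl PoszM natz.
have k_neq0 : k%:Z != 0 by rewrite -lt0n ltnW.
by rewrite mxE => /(mulfI k_neq0).
Qed.

Lemma bounded_weighted_catalan_walk_sum (n : nat) :
  bounded_weighted_catalan k_gt1 b s n = walk_sum (k * n) 0.
Proof.
rewrite walk_sum_tuples; apply: eq_big => [p|p _].
  rewrite add0r /balanced_ballot_path /height_bounded path_point_diagonal.
  rewrite -andbA andbC; congr (_ && _).
  apply/andP/forallP=> [[/forallP dec_p /forallP le_p] j | adm_p].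
    by rewrite add0r; apply/andP.
  by split; apply/forallP=> j; have /andP[] := adm_p j; rewrite add0r.
by rewrite /path_weight big_mkcond; apply: eq_bigr => j _; rewrite add0r.
Qed.

(** * Reduction to finitely many points *)

(** Writing [(k - 1) x_1] as a sum of copies of [x_1] turns the height into the
    sum of the deficits; the term of index [up] vanishes. *)
Lemma height_sum (x : 'rV[int]_k) :
  height k_gt1 x = \sum_i (x 0 up - x 0 i).
Proof.
rewrite sumrB sumr_const card_ord -mulr_natl natz /height mulrBl mul1r.
rewrite [in RHS](bigD1 up) //= opprD addrA; congr (_ - _).
by apply: eq_bigl => i; rewrite lt0n.
Qed.

Lemma height_shift (c : int) (x : 'rV[int]_k) :
  height k_gt1 (x + const_mx c) = height k_gt1 x.
Proof.
by rewrite !height_sum; apply: eq_bigr => i _; rewrite !mxE opprD addrACA subrr addr0.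
Qed.

Lemma admissible_shift (c : int) (x : 'rV[int]_k) :
  admissible (x + const_mx c) = admissible x.
Proof.
rewrite /admissible height_shift; congr (_ && _).
apply: eq_forallb => i; apply: eq_forallb => j.
by rewrite !mxE lerD2r.
Qed.

Lemma on_diagonal_shift (c : int) (x : 'rV[int]_k) :
  on_diagonal (x + const_mx c) = on_diagonal x.
Proof.
rewrite /on_diagonal !mxE (_ : const_mx (x 0 up + c)
  = const_mx (x 0 up) + const_mx c); last by apply/rowP=> i; rewrite !mxE.
by rewrite (inj_eq (addIr _)).
Qed.

Lemma walk_sum_shift (L : nat) (c : int) (x : 'rV[int]_k) :
  walk_sum L (x + const_mx c) = walk_sum L x.
Proof.
elim: L x => [|L IHL] x /=; rewrite admissible_shift ?on_diagonal_shift //.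
case: ifP => // _; apply: eq_bigr => i _.
by rewrite /step_weight height_shift addrAC IHL.
Qed.

Lemma walk_sum_inadmissible (L : nat) (x : 'rV[int]_k) :
  ~~ admissible x -> walk_sum L x = 0.
Proof. by case: L => [|L] /negPf /= ->. Qed.

(** The point of the translation class that has first coordinate [0], when
    [a] is the family of deficits of a point. *)
Definition deficit_point (a : {ffun 'I_k -> 'I_s.+1}) : 'rV[int]_k :=
  \row_i - (a i : nat)%:Z.

(** A deficit is one of the nonnegative terms of the sum [height_sum], hence
    it is at most [s]. *)
Lemma admissible_deficit (x : 'rV[int]_k) :
  admissible x -> exists a, x = deficit_point a + const_mx (x 0 up).
Proof.
move=> /andP[/forallP dec_x le_s].
have deficit_ge0 i : 0 <= x 0 up - x 0 i.
  by have /forallP/(_ i) := dec_x up; rewrite subr_ge0.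
exists [ffun i => inord `|(x 0 up - x 0 i)%R|%N].
apply/rowP=> i; rewrite !mxE ffunE inordK.
  by rewrite gez0_abs // opprB subrK.
rewrite ltnS -lez_nat gez0_abs //; apply: le_trans le_s.
by rewrite height_sum (bigD1 i) //= lerDl sumr_ge0.
Qed.

Variables (m : nat) (m_gt0 : (0 < m)%N).

(** The bound is written [m.-1.+1] rather than [m] so that [inord] applies. *)
Definition residues (L : nat) : {ffun {ffun 'I_k -> 'I_s.+1} -> 'I_m.-1.+1} :=
  [ffun a => inord `|(walk_sum L (deficit_point a) %% m%:Z)%Z|%N].

(** A point whose deficits are out of range is inadmissible and has walk sum
    [0]; any other point is a diagonal translate of some [deficit_point a]. *)
Lemma residues_eqP (i j : nat) :
  residues i = residues j <->
  forall x, (walk_sum i x = walk_sum j x %[mod m%:Z])%Z.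
Proof.
have m_neq0 : m%:Z != 0 by rewrite -lt0n.
split=> [eq_r x | eq_w]; last by apply/ffunP=> a; rewrite !ffunE eq_w.
have [adm_x | nadm_x] := boolP (admissible x); last first.
  by rewrite !walk_sum_inadmissible.
have [a ->] := admissible_deficit adm_x; rewrite !walk_sum_shift.
have lt_mod (c : int) : (`|(c %% m%:Z)%Z| < m.-1.+1)%N.
  by rewrite prednK // -ltz_nat gez0_abs ?modz_ge0 // ltz_pmod.
have /(congr1 val) := congr1 (fun r : {ffun _} => r a) eq_r.
rewrite !ffunE /= !inordK // => eq_abs.
by rewrite -[LHS]gez0_abs ?modz_ge0 // eq_abs gez0_abs ?modz_ge0.
Qed.

(** The coefficients of the recurrence for [walk_sum] are integers independent
    of the length, so congruences pass through it. *)
Lemma residues_step (i j : nat) :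
  residues i = residues j -> residues i.+1 = residues j.+1.
Proof.
move=> /residues_eqP eq_w; apply/residues_eqP=> x /=.
case: ifP => // _; apply/eqP; rewrite eqz_mod_dvd -sumrB.
apply: rpred_sum => e _; rewrite -mulrBr dvdz_mull // -eqz_mod_dvd.
exact/eqP.
Qed.

End Walks.

Theorem theorem3p3 (k : nat) (k_gt1 : (1 < k)%N) (s : nat) (b : nat -> int)
    (m : nat) (m_gt0 : (0 < m)%N) :
  exists N t : nat,
    [/\ (0 < N)%N, (0 < t)%N &
      forall n : nat, (N <= n)%N ->
        (bounded_weighted_catalan k_gt1 b s (n + t)%N
           = bounded_weighted_catalan k_gt1 b s n %[mod m%:Z])%Z].
Proof.
have [N [t [t_gt0 per]]] :=
  eventually_periodic_iter (residues_step (k_gt1 := k_gt1) (s := s) (b := b) m_gt0).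
exists N.+1, t; split=> // n lt_Nn; rewrite !bounded_weighted_catalan_walk_sum.
move: 0; apply/(residues_eqP _ _ _ m_gt0); rewrite mulnDr.
have le_N : (N <= k * n)%N.
  by rewrite (leq_trans (ltnW lt_Nn)) // leq_pmull // ltnW.
(* Advancing n by t advances the number of steps by k periods. *)
suff per_mul q : residues k_gt1 s b m (k * n + q * t)
               = residues k_gt1 s b m (k * n) by apply: per_mul.
elim: q => [|q IHq]; first by rewrite mul0n addn0.
by rewrite mulSn addnCA addnC per // (leq_trans le_N) // leq_addr.
Qed.
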